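(* Let $n\ge1$ and let $U$ be a depth-$d$ $\mathrm{QAC}^0$ circuit on $n+a$ qubits, with $n$ input qubits and $a$ ancilla qubits initialized in a density operator $\varphi$ on $a$ qubits. Let $p:\{0,1\}^n\to\mathbb R$ be the probability that $U$ outputs $1$, i.e. $p(x)=\mathrm{Tr}\big[(|1\rangle\langle1|\otimes I)\,U(|x\rangle\langle x|\otimes\varphi)U^\dagger\big]$. Then $\deg_\varepsilon(p)=\tilde O\big((n+a)^{1-3^{-d}}\big)$ for $\varepsilon=O(d/n)$.
   Context: For $f:\{0,1\}^n\to\mathbb R$ write $f=\sum_{S\subseteq[n]}\hat f(S)\chi_S$ with $\chi_S(x)=(-1)^{\sum_{i\in S}x_i}$; $\deg(f)=\max\{|S|:\hat f(S)\ne0\}$ and $\deg_\varepsilon(f)=\min\{\deg(g):\max_x|f(x)-g(x)|\le\varepsilon\}$. A depth-$d$ $\mathrm{QAC}^0$ circuit on $m$ qubits is a unitary $U=L_dM_d\cdots L_1M_1L_0$ where each $L_i$ is a tensor product of single-qubit unitaries and each $M_i$ is a tensor product of multi-qubit CZ gates $I-2|1^s\rangle\langle1^s|$ on pairwise disjoint sets of qubits. $O(\cdot)$ hides an absolute constant; $\tilde O(\cdot)$ hides absolute constants and polylogarithmic factors in $n+a$. *)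

(* Defs.v *)
From HB Require Import structures.
From mathcomp Require Import all_boot all_order all_algebra.
From mathcomp Require Import all_classical all_reals.
From mathcomp Require Import exp.
From mathcomp Require Import complex.

Set Implicit Arguments.
Unset Strict Implicit.
Unset Printing Implicit Defensive.

Import Order.TTheory GRing.Theory Num.Theory.
Local Open Scope ring_scope.

Section Defs.
Variable R : realType.
Local Notation C := (R[i]).

Definition bits (m : nat) := {ffun 'I_m -> bool}.

(* linear operators on (C^2)^{\otimes m}, as matrices indexed by basis strings *)
Definition op (m : nat) := bits m -> bits m -> C.

Definition op_mul m (A B : op m) : op m :=
  fun x y => \sum_(z : bits m) A x z * B z y.

Definition op_adj m (A : op m) : op m := fun x y => conjc (A y x).

Definition op_id m : op m := fun x y => (x == y)%:R.

Definition op_trace m (A : op m) : C := \sum_(x : bits m) A x x.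

(* single-qubit operator, indexed by bool (false = |0>, true = |1>) *)
Definition qubit_op := bool -> bool -> C.

Definition unitary1 (u : qubit_op) : Prop :=
  forall b b', \sum_(c : bool) u b c * conjc (u b' c) = (b == b')%:R.

Definition single_layer m (u : 'I_m -> qubit_op) : op m :=
  fun x y => \prod_(i < m) u i (x i) (y i).

(* tensor product of CZ gates I - 2|1^s><1^s| on the (pairwise disjoint)
   qubit sets S in P; all other qubits carry the identity *)
Definition cz_layer m (P : {set {set 'I_m}}) : op m :=
  fun x y => (x == y)%:R *
    \prod_(S in P) (if [forall i in S, x i] then -1 else 1).

Fixpoint qac0_circuit m (u : nat -> 'I_m -> qubit_op)
    (P : nat -> {set {set 'I_m}}) (d : nat) : op m :=
  match d with
  | 0 => single_layer (u 0%N)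
  | k.+1 => op_mul (single_layer (u k.+1))
              (op_mul (cz_layer (P k.+1)) (qac0_circuit u P k))
  end.

Definition is_QAC0 m (d : nat) (U : op m) : Prop :=
  exists (u : nat -> 'I_m -> qubit_op) (P : nat -> {set {set 'I_m}}),
    (forall k i, (k <= d)%N -> unitary1 (u k i)) /\
    (forall k, (1 <= k <= d)%N -> finset.trivIset (P k) /\ (@finset.set0 _) \notin P k) /\
    (forall x y, U x y = qac0_circuit u P d x y).

(* density operator: positive semidefinite (hence Hermitian) with trace 1 *)
Definition density m (phi : op m) : Prop :=
  (forall v : bits m -> C,
     0 <= \sum_(z : bits m) \sum_(z' : bits m) conjc (v z) * phi z z' * v z')
  /\ op_trace phi = 1.

Definition input_state n a (x : bits n) (phi : op a) : op (n + a) :=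
  fun w w' =>
    ([forall i : 'I_n, w (lshift a i) == x i] &&
     [forall i : 'I_n, w' (lshift a i) == x i])%:R *
    phi [ffun j => w (rshift n j)] [ffun j => w' (rshift n j)].

Definition accept_prob n a (o : 'I_(n + a)) (U : op (n + a)) (phi : op a)
    (x : bits n) : R :=
  complex.Re (\sum_(w : bits (n + a) | w o)
        op_mul U (op_mul (input_state x phi) (op_adj U)) w w).

Definition chi n (S : {set 'I_n}) (x : bits n) : R :=
  (-1) ^+ (\sum_(i in S) (x i : nat))%N.

Definition fourier n (f : bits n -> R) (S : {set 'I_n}) : R :=
  (2%:R ^- n) * \sum_(x : bits n) f x * chi S x.

Definition fdeg n (f : bits n -> R) : nat :=
  \max_(S : {set 'I_n} | fourier f S != 0) #|S|.

Definition approx_deg_le n (f : bits n -> R) (eps D : R) : Prop :=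
  exists g : bits n -> R,
    (forall x, `|f x - g x| <= eps) /\ (fdeg g)%:R <= D.

End Defs.

(* Main.v *)
Require Import Defs.
From HB Require Import structures.
From mathcomp Require Import all_boot all_order all_algebra.
From mathcomp Require Import all_classical all_reals.
From mathcomp Require Import sequences exp.
From mathcomp Require Import complex.
From mathcomp Require Import ring lra.
Import Order.TTheory GRing.Theory Num.Theory.
Local Open Scope ring_scope.

(** In the Heisenberg picture the output projector is a one-qubit operator, pulled
    back through the layers one at a time.  Put [m = n + a] and [y_j = m^(3^-j)].
    Conjugation by single-qubit unitaries preserves the locality degree.  In a CZ
    layer, the gates on at most [y^2] qubits ([y = y_(j+1)]) are conjugated exactly
    and multiply the degree by [y^2]; the AND inside each larger gate [S] is replaced
    by a power of a Chebyshev polynomial of degree [O(sqrt |S|)], which adds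
    [O(log m) * sum sqrt |S| <= O(log m) * m / y] because [sqrt |S| <= |S| / y] and
    the gates are disjoint.  As [y_j = y_(j+1)^3], a degree of order [m / y_j]
    becomes one of order [m / y_(j+1)], and the constants only add up, to [O(d log m)].
    Each layer costs an error [O(1/m)], measured by pairing with positive
    semidefinite operators.  If [d > ln m] then the trivial bound [n] suffices. *)

Set Implicit Arguments.
Unset Strict Implicit.
Unset Printing Implicit Defensive.

(** * Chebyshev approximation of AND *)

Section Chebyshev.
Variable R : realFieldType.
Implicit Types t u : R.

(* The pair [(T_k(t), U_(k-1)(t))] of Chebyshev polynomials. *)
Fixpoint cheb t (k : nat) : R * R :=
  if k is k'.+1 then
    let p := cheb t k' in (t * p.1 - (1 - t ^+ 2) * p.2, t * p.2 + p.1)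
  else (1, 0).

(** The Pell equation [T^2 - (t^2 - 1) U^2 = 1]; on [[0, 1]] both terms on the left are nonnegative,
    which bounds [T_k] there. *)
Lemma cheb_pell t k : (cheb t k).1 ^+ 2 + (1 - t ^+ 2) * (cheb t k).2 ^+ 2 = 1.
Proof.
elim: k => [|k] /=; first by rewrite expr0n /= mulr0 addr0 expr1n.
by move: (cheb t k) => [a b] /= h; rewrite -[RHS]h; ring.
Qed.

Lemma cheb_le1 t k : 0 <= t <= 1 -> `|(cheb t k).1| <= 1.
Proof.
move=> /andP[t0 t1]; have := cheb_pell t k.
have : 0 <= (1 - t ^+ 2) * (cheb t k).2 ^+ 2.
  by rewrite mulr_ge0 ?sqr_ge0// subr_ge0 expr_le1.
rewrite ler_norml; nra.
Qed.

(** Growth to the right of 1: one step of the recurrence raises the first component by at least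
    [u (2k + 1)], of which [2 u k] comes from the second component, so the two bounds are proved
    together. *)
Lemma cheb_ge u k : 0 <= u ->
  1 + u * k%:R ^+ 2 <= (cheb (1 + u) k).1 /\ k%:R <= (cheb (1 + u) k).2.
Proof.
move=> u0; elim: k => [|k [IT IV]] /=; first by split; rewrite // expr0n mulr0 addr0.
have k0 : 0 <= k%:R :> R by [].
move: (cheb _ k) IT IV => [a b] /=; rewrite -natr1; set K := k%:R in k0 *.
move=> IT IV; split; last by nra.
have uK : 0 <= u * K ^+ 2 by rewrite mulr_ge0 ?sqr_ge0.
have h1 : u * 1 <= u * a by rewrite ler_wpM2l //; lra.
have h2 : u * K <= u * b by rewrite ler_wpM2l.
have h3 : 0 <= u ^+ 2 * b by rewrite mulr_ge0 ?sqr_ge0//; lra.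
lra.
Qed.

(* Power of [T_k(j/(s-1)) / T_k(s/(s-1))], [T_k] Chebyshev: the numerator is
   at most 1 for [j < s], while the denominator is at least 2 once [s <= k^2].  The
   even power makes the value nonnegative, so that [1 - 2 * and_poly] stays in [-1, 1]. *)
Definition and_poly (s k r : nat) (j : R) : R :=
  ((cheb (j / (s.-1)%:R) k).1 / (cheb (s%:R / (s.-1)%:R) k).1) ^+ r.*2.

(** The point [s / (s - 1)] is [1 + u] with [u = 1 / (s - 1)], where quadratic growth already gives
    [1 + k^2 / (s - 1)]. *)
Lemma cheb_top s k : (1 < s)%N -> (s <= k ^ 2)%N ->
  2 <= (cheb (s%:R / (s.-1)%:R : R) k).1.
Proof.
case: s => [|[|s]] // _ sk /=.
have s0 : 0 < (s.+1)%:R :> R by [].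
have -> : (s.+2)%:R / (s.+1)%:R = 1 + (s.+1)%:R^-1 :> R.
  by rewrite -(@natr1 _ s.+1); field; lra.
have /(cheb_ge k)[+ _] : 0 <= (s.+1)%:R^-1 :> R by rewrite invr_ge0.
apply: le_trans; rewrite -[2]/(1 + 1) lerD2l mulrC ler_pdivlMr // mul1r.
by rewrite -natrX ler_nat ltnW.
Qed.

Lemma and_poly1 s k r : (1 < s)%N -> (s <= k ^ 2)%N -> and_poly s k r s%:R = 1.
Proof.
move=> s1 sk; rewrite /and_poly divff ?expr1n//.
by have := cheb_top s1 sk; move=> h; apply: lt0r_neq0; lra.
Qed.

Lemma and_poly_ge0 s k r j : 0 <= and_poly s k r j.
Proof. by rewrite /and_poly -mul2n exprM exprn_ge0 // sqr_ge0. Qed.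

Lemma and_poly_le s k r j : (1 < s)%N -> (s <= k ^ 2)%N -> (j < s)%N ->
  and_poly s k r j%:R <= 4^-1 ^+ r.
Proof.
move=> s1 sk js; have hT := cheb_top s1 sk; rewrite /and_poly -mul2n exprM.
have s0 : 0 < (s.-1)%:R :> R by rewrite ltr0n; case: s s1 {sk js hT} => [|[]].
rewrite lerXn2r ?nnegrE ?sqr_ge0 ?invr_ge0//.
have : `|(cheb (j%:R / s.-1%:R) k).1| <= 1 :> R.
  apply: cheb_le1; rewrite divr_ge0 ?(ltW s0)//= ler_pdivrMr // mul1r ler_nat.
  by case: s s1 js {sk s0 hT}.
rewrite expr_div_n ler_pdivrMr; last by rewrite exprn_gt0//; lra.
by rewrite ler_norml => /andP[]; nra.
Qed.

End Chebyshev.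

(** * Pairing operators with states *)

Section TracePairing.
Local Open Scope complex_scope.
Variables (R : realType) (m : nat).
Local Notation C := (R[i]).
Local Notation op := (op R m).
Implicit Types (A B X Y rho : op) (D : bits m -> R).

Definition psd rho := forall v : bits m -> C,
  0 <= \sum_(z : bits m) \sum_(z' : bits m) conjc (v z) * rho z z' * v z'.

Definition sandwich A rho : op := op_mul A (op_mul rho (op_adj A)).

Definition diag_conj D X : op := fun x y => (D x)%:C * X x y * (D y)%:C.

Definition pairing X rho : C := op_trace (op_mul X rho).

Definition op_sub X Y : op := fun x y => X x y - Y x y.

Lemma op_ext X Y : (forall x y, X x y = Y x y) -> X = Y.
Proof. by move=> h; apply/funext => x; apply/funext => y. Qed.

Lemma op_mulA A B X : op_mul A (op_mul B X) = op_mul (op_mul A B) X.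
Proof.
apply: op_ext => x y; rewrite /op_mul.
under eq_bigr do rewrite mulr_sumr.
rewrite exchange_big /=; apply: eq_bigr => z _.
by rewrite mulr_suml; apply: eq_bigr => w _; rewrite mulrA.
Qed.

Lemma op_adjK A : op_adj (op_adj A) = A.
Proof. by apply: op_ext => x y; rewrite /op_adj conjcK. Qed.

Lemma op_adjM A B : op_adj (op_mul A B) = op_mul (op_adj B) (op_adj A).
Proof.
apply: op_ext => x y; rewrite /op_adj /op_mul rmorph_sum.
by apply: eq_bigr => z _; rewrite rmorphM mulrC.
Qed.

Lemma op_trace_mulC A B : op_trace (op_mul A B) = op_trace (op_mul B A).
Proof.
rewrite /op_trace /op_mul exchange_big /=.
by apply: eq_bigr => x _; apply: eq_bigr => y _; rewrite mulrC.
Qed.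

Lemma pairingE X rho : pairing X rho = \sum_x \sum_y X x y * rho y x.
Proof. by []. Qed.

Lemma sandwichM A B rho : sandwich (op_mul A B) rho = sandwich A (sandwich B rho).
Proof. by rewrite /sandwich op_adjM !op_mulA. Qed.

Lemma pairing_sandwich A X rho :
  pairing X (sandwich A rho) = pairing (sandwich (op_adj A) X) rho.
Proof.
by rewrite /pairing /sandwich op_adjK !op_mulA op_trace_mulC !op_mulA.
Qed.

Lemma sandwich_adjE A X x y :
  sandwich (op_adj A) X x y = \sum_z \sum_w conjc (A z x) * X z w * A w y.
Proof.
rewrite /sandwich op_adjK /op_mul; apply: eq_bigr => z _.
by rewrite mulr_sumr; apply: eq_bigr => w _; rewrite mulrA.
Qed.

(** The quadratic form of the conjugated operator at [v] is that of [rho] at the vector [A^* v]. *)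
Lemma psd_sandwich A rho : psd rho -> psd (sandwich A rho).
Proof.
move=> h v; have := h (fun z => \sum_x conjc (A x z) * v x); congr (_ <= _).
rewrite -[A]op_adjK; set B := op_adj A.
under [RHS]eq_bigr do under eq_bigr do rewrite sandwich_adjE mulr_sumr mulr_suml.
under [RHS]eq_bigr do rewrite exchange_big /=.
rewrite [RHS]exchange_big /=; apply: eq_bigr => z _.
under [RHS]eq_bigr do under eq_bigr do rewrite mulr_sumr mulr_suml.
under [RHS]eq_bigr do rewrite exchange_big /=.
rewrite [RHS]exchange_big /=; apply: eq_bigr => w _.
rewrite rmorph_sum !mulr_suml; apply: eq_bigr => x _.
rewrite mulr_sumr; apply: eq_bigr => y _.
by rewrite /B /op_adj rmorphM /= !conjcK; ring.
Qed.

Lemma conjcZ (a : R) (z : C) : conjc (a%:C * z) = a%:C * conjc z.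
Proof. by rewrite rmorphM; congr (_ * _); apply: conjc_real. Qed.

Lemma psd_diag_conj D rho : psd rho -> psd (diag_conj D rho).
Proof.
move=> h v; have := h (fun z => (D z)%:C * v z); congr (_ <= _).
apply: eq_bigr => z _; apply: eq_bigr => w _.
by rewrite /diag_conj conjcZ; ring.
Qed.

Lemma pairing_diag_conj D X rho :
  pairing X (diag_conj D rho) = pairing (diag_conj D X) rho.
Proof.
rewrite !pairingE; apply: eq_bigr => x _; apply: eq_bigr => y _.
by rewrite /diag_conj; ring.
Qed.

Lemma psd_diag_ge0 rho x : psd rho -> 0 <= rho x x.
Proof.
move=> /(_ (fun y => (y == x)%:R)); rewrite (bigD1 x) //= (bigD1 x) //=.
rewrite eqxx conjc1 mul1r mulr1 !big1 ?addr0//.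
- by move=> i /negPf->; rewrite big1// => j _; rewrite conjc0 !mul0r.
- by move=> i /negPf->; rewrite mulr0.
Qed.

Lemma Re_ge0 (z : C) : 0 <= z -> 0 <= complex.Re z.
Proof. by rewrite lecE => /andP[]. Qed.

Lemma Re_sum (I : finType) (P : pred I) (F : I -> C) :
  complex.Re (\sum_(i | P i) F i) = \sum_(i | P i) complex.Re (F i).
Proof. by elim/big_rec2: _ => // i _ x _ <-; case: (F i) x => a b []. Qed.

Lemma ReZ (a : R) (z : C) : complex.Re (a%:C * z) = a * complex.Re z.
Proof. by case: z => x y /=; rewrite mul0r subr0. Qed.

Lemma ReB (z w : C) : complex.Re (z - w) = complex.Re z - complex.Re w.
Proof. by case: z w => [? ?] []. Qed.

Lemma Re_trace_ge0 rho : psd rho -> 0 <= complex.Re (op_trace rho).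
Proof.
by move=> h; rewrite Re_sum sumr_ge0 // => x _; apply/Re_ge0/psd_diag_ge0.
Qed.

Lemma trace_diag_conj_le D rho b : psd rho -> (forall x, `|D x| <= b) ->
  complex.Re (op_trace (diag_conj D rho)) <= b ^+ 2 * complex.Re (op_trace rho).
Proof.
move=> h hD; rewrite !Re_sum mulr_sumr; apply: ler_sum => x _.
rewrite /diag_conj mulrAC -rmorphM ReZ; apply: ler_wpM2r.
  exact/Re_ge0/psd_diag_ge0.
have := hD x; have := normr_ge0 (D x); rewrite -expr2 -real_normK ?num_real//.
by nra.
Qed.

(** A dual form of the operator norm: it says that the Hermitian part of [X] has norm at most [c].
    In this form a conjugation can be moved from the observable to the state. *)
Definition state_bounded X (c : R) := forall rho, psd rho ->
  `|complex.Re (pairing X rho)| <= c * complex.Re (op_trace rho).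

Lemma pairing_sub X Y rho :
  complex.Re (pairing (op_sub X Y) rho) =
  complex.Re (pairing X rho) - complex.Re (pairing Y rho).
Proof.
rewrite -ReB !pairingE -sumrB; congr complex.Re; apply: eq_bigr => x _.
by rewrite -sumrB; apply: eq_bigr => y _; rewrite mulrBl.
Qed.

(** Moved onto the state, [D] multiplies the trace by at most [b^2]. *)
Lemma state_bounded_diag_conj D X c b : 0 <= c -> state_bounded X c ->
  (forall x, `|D x| <= b) -> state_bounded (diag_conj D X) (c * b ^+ 2).
Proof.
move=> c0 h hD rho hr; rewrite -pairing_diag_conj.
apply: le_trans (h _ (psd_diag_conj D hr)) _.
by rewrite -mulrA ler_wpM2l// trace_diag_conj_le.
Qed.

Lemma state_bounded_sub_trans X Y Z a b :
  state_bounded (op_sub X Y) a -> state_bounded (op_sub Y Z) b ->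
  state_bounded (op_sub X Z) (a + b).
Proof.
move=> hX hY rho hr; have := hX rho hr; have := hY rho hr.
rewrite !pairing_sub mulrDl => h1 h2.
rewrite -(subrKA (complex.Re (pairing Y rho))).
by apply: le_trans (ler_normD _ _) _; rewrite lerD.
Qed.

Lemma diag_conj_sub D X Y :
  diag_conj D (op_sub X Y) = op_sub (diag_conj D X) (diag_conj D Y).
Proof. by apply: op_ext => x y; rewrite /diag_conj /op_sub; ring. Qed.

(* Polarization: with [S = D + D'] and [E = (D - D') / eta],
   [4 (D X D - D' X D') = eta ((S + E) X (S + E) - (S - E) X (S - E))]. *)
Lemma state_bounded_diag_perturb D D' X c eta : 0 <= c -> 0 < eta ->
  state_bounded X c -> (forall x, `|D x| <= 1) -> (forall x, `|D' x| <= 1) ->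
  (forall x, `|D x - D' x| <= eta) ->
  state_bounded (op_sub (diag_conj D X) (diag_conj D' X)) (5 * eta * c).
Proof.
move=> c0 e0 hX hD hD' hE.
pose E x := (D x - D' x) / eta; pose S x := D x + D' x.
have hE1 x : `|E x| <= 1.
  by rewrite /E normrM normfV (gtr0_norm e0) ler_pdivrMr// mul1r.
have hS x : `|S x| <= 2.
  by apply: le_trans (ler_normD _ _) _; have := hD x; have := hD' x; lra.
have hP x : `|S x + E x| <= 3.
  by apply: le_trans (ler_normD _ _) _; have := hS x; have := hE1 x; lra.
have hM x : `|S x - E x| <= 3.
  by apply: le_trans (ler_normB _ _) _; have := hS x; have := hE1 x; lra.
move=> rho hr.
have := state_bounded_diag_conj c0 hX hP hr.
have := state_bounded_diag_conj c0 hX hM hr.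
have -> : complex.Re (pairing (op_sub (diag_conj D X) (diag_conj D' X)) rho) =
  eta / 4 * (complex.Re (pairing (diag_conj (fun x => S x + E x) X) rho) -
             complex.Re (pairing (diag_conj (fun x => S x - E x) X) rho)).
  rewrite -pairing_sub -ReZ !pairingE mulr_sumr; congr complex.Re.
  apply: eq_bigr => x _; rewrite mulr_sumr; apply: eq_bigr => y _.
  have eD z : D z = (S z + eta * E z) / 2.
    by rewrite /S /E; field; apply: lt0r_neq0.
  have eD' z : D' z = (S z - eta * E z) / 2.
    by rewrite /S /E; field; apply: lt0r_neq0.
  rewrite /op_sub /diag_conj !eD !eD'; move: (S x) (S y) (E x) (E y) => s s' e e'.
  by field.
have := Re_trace_ge0 hr.
set t := complex.Re (op_trace rho).
set p := complex.Re (pairing (diag_conj (fun x => S x - E x) X) rho).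
set q := complex.Re (pairing (diag_conj (fun x => S x + E x) X) rho).
move=> t0 hp hq; rewrite normrM ger0_norm; last by apply: divr_ge0 => //; apply: ltW.
(* Each pairing is at most [3^2 c t], since [S + E] and [S - E] are bounded by 3; the resulting
   [18 eta / 4] is rounded up to [5 eta]. *)
have : `|q - p| <= 18 * (c * t).
  by apply: le_trans (ler_normB _ _) _; lra.
have : 0 <= c * t by rewrite mulr_ge0.
move=> ct h; apply: (@le_trans _ _ (eta / 4 * (18 * (c * t)))).
  by rewrite ler_wpM2l // divr_ge0// ltW.
have : 0 <= eta * (c * t) by rewrite mulr_ge0// ltW.
lra.
Qed.

End TracePairing.

(** * Locality degree *)

Section Locality.
Local Open Scope complex_scope.
Variables (R : realType) (m : nat).
Local Notation C := (R[i]).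
Local Notation op := (op R m).
Implicit Types (A B X Y rho : op) (D : bits m -> R) (S T : {set 'I_m}).

(* [X] is the identity off [S]: [X = X_S (x) id]. *)
Definition local_on S X :=
  (forall x y : bits m, X x y != 0 -> forall i, i \notin S -> x i = y i) /\
  (forall x y x' y' : bits m, (forall i, i \in S -> x i = x' i /\ y i = y' i) ->
    (forall i, i \notin S -> x i = y i /\ x' i = y' i) -> X x y = X x' y').

(** The span of the [l]-local operators, scalars being absorbed by [local_scale]. As an inductive
    predicate it reduces statements on additive maps to a single local term, without fixing a
    decomposition. *)
Inductive degop (l : nat) : op -> Prop :=
| degop_local S X of local_on S X & (#|S| <= l)%N : degop l X
| degop_add X Y of degop l X & degop l Y : degop l (fun x y => X x y + Y x y).

Lemma degop_map l l' (F : op -> op) :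
  (forall X Y, F (fun x y => X x y + Y x y) = fun x y => F X x y + F Y x y) ->
  (forall S X, local_on S X -> (#|S| <= l)%N -> degop l' (F X)) ->
  forall X, degop l X -> degop l' (F X).
Proof.
move=> hD hS X; elim=> {X} [S X hX hl|X Y _ hX _ hY]; first exact: (hS S).
by rewrite hD; apply: degop_add.
Qed.

Lemma degop_leq l l' X : (l <= l')%N -> degop l X -> degop l' X.
Proof.
move=> h; apply: (@degop_map l l' id) => // S Y hY hS.
by apply: (degop_local hY); apply: leq_trans h.
Qed.

Lemma local0 S : local_on S (fun _ _ => 0).
Proof. by split=> // x y; rewrite eqxx. Qed.

Lemma degop_sum l (I : finType) (P : pred I) (F : I -> op) :
  (forall i, P i -> degop l (F i)) ->
  degop l (fun x y => \sum_(i | P i) F i x y).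
Proof.
move=> h.
have -> : (fun x y => \sum_(i | P i) F i x y) =
  \big[(fun X Y : op => (fun x y => X x y + Y x y))/(fun _ _ => 0)]_(i | P i) F i.
  by apply: op_ext => x y; rewrite (big_morph (fun X : op => X x y) (id1 := 0)
    (op1 := fun a b => a + b)).
elim/big_rec: _ => [|i X hi hX]; last exact: (degop_add (h i hi) hX).
by apply: (degop_local (local0 finset.set0)); rewrite cards0.
Qed.

Lemma local_scale S X (c : C) : local_on S X -> local_on S (fun x y => c * X x y).
Proof.
move=> [h1 h2]; split=> [x y|x y x' y' hS hN]; last by rewrite (h2 _ _ x' y').
by rewrite mulf_eq0 negb_or => /andP[_]; apply: h1.
Qed.

Lemma local_single S (u : 'I_m -> qubit_op R) :
  (forall i, i \notin S -> forall b b', u i b b' = (b == b')%:R) ->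
  local_on S (single_layer u).
Proof.
move=> hu; rewrite /single_layer; split=> [x y h i hi|x y x' y' hS hN].
  apply/eqP; apply: contraNT h => hxy.
  by rewrite (bigD1 i) //= hu // (negPf hxy) mul0r.
apply: eq_bigr => i _; have [/hS[-> ->]//|hi] := boolP (i \in S).
by have [-> ->] := hN i hi; rewrite !hu // !eqxx.
Qed.

(** Strings vanishing off [S] are canonical representatives of the basis strings on the qubits of
    [S]. *)
Definition supported S (x : bits m) := [forall i, x i ==> (i \in S)].

Definition mask S (x : bits m) : bits m := [ffun i => (i \in S) && x i].

Lemma supported_mask S x : supported S (mask S x).
Proof. by apply/forallP => i; rewrite ffunE; case: (i \in S) => //=; rewrite implybT. Qed.

Lemma supported_out S x i : supported S x -> i \notin S -> x i = false.
Proof. by move=> /forallP/(_ i); case: (x i) => //= ->. Qed.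

(** The qubit factors of the matrix unit [|u_S><v_S|] tensored with the identity off [S]. *)
Definition unit_op S (u v : bits m) i : qubit_op R := fun b c =>
  if i \in S then ((b == u i) && (c == v i))%:R else (b == c)%:R.

(** Expansion in matrix units on [S]. Each unit is a product operator, so its conjugate by a
    single-qubit layer can be computed factor by factor. *)
Lemma local_decomp S X : local_on S X ->
  X = fun x y => \sum_(p : bits m * bits m | supported S p.1 && supported S p.2)
        X p.1 p.2 * single_layer (unit_op S p.1 p.2) x y.
Proof.
move=> [h1 h2]; apply: op_ext => x y.
have [hxy|] := boolP [forall i, (i \notin S) ==> (x i == y i)]; last first.
  case/forallPn => i; rewrite negb_imply => /andP[hi hxy].
  have -> : X x y = 0 by apply/eqP; apply: contraNT hxy => /h1 ->.
  rewrite big1 // => p _; rewrite /single_layer (bigD1 i) //= /unit_op.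
  by rewrite (negPf hi) (negPf hxy) mul0r mulr0.
have {}hxy i : i \notin S -> x i = y i by move=> hi; have /forallP/(_ i) := hxy; rewrite hi => /eqP.
(* When [x] and [y] agree off [S], only the unit indexed by their restrictions to [S] has a nonzero
   entry at [(x, y)]. *)
rewrite (bigD1 (mask S x, mask S y)) /= ?supported_mask //.
rewrite [X in _ + X]big1 => [|[u v] /= /andP[/andP[hu hv] ne]].
  rewrite addr0 /single_layer big1 ?mulr1 => [|i _].
    apply: h2 => i hi; first by rewrite !ffunE hi.
    by rewrite hxy // !ffunE (negPf hi).
  by rewrite /unit_op !ffunE; case: (boolP (i \in S)) => hi /=; rewrite ?eqxx// hxy ?eqxx.
have [->|nz] := eqVneq (single_layer (unit_op S u v) x y) 0; first by rewrite mulr0.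
case/eqP: ne; have huv i : i \in S -> x i = u i /\ y i = v i.
  move=> hi; move: nz; rewrite /single_layer (bigD1 i) //= /unit_op hi.
  by case: (x i =P u i) => [->|_]; case: (y i =P v i) => [->|_] //=; rewrite mul0r eqxx.
congr pair; apply/ffunP => i; rewrite ffunE; have [/huv[? ?]//|hi] := boolP (i \in S).
- exact: supported_out hu hi.
- exact: supported_out hv hi.
Qed.

End Locality.

(** * Conjugation by single-qubit layers and by small CZ gates *)

Section Layers.
Local Open Scope complex_scope.
Variables (R : realType) (m : nat).
Local Notation C := (R[i]).
Local Notation op := (op R m).
Implicit Types (A B X Y rho : op) (S T : {set 'I_m}) (u v : 'I_m -> qubit_op R).

Lemma single_layerM u v : op_mul (single_layer u) (single_layer v) =
  single_layer (fun i b c => \sum_(e : bool) u i b e * v i e c).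
Proof.
apply: op_ext => x y; rewrite /op_mul /single_layer bigA_distr_bigA /=.
by apply: eq_bigr => z _; rewrite big_split.
Qed.

Lemma single_layer_adj u :
  op_adj (single_layer u) = single_layer (fun i b c => conjc (u i c b)).
Proof. by apply: op_ext => x y; rewrite /op_adj /single_layer rmorph_prod. Qed.

(** A right inverse of a square matrix is a left inverse; [bool] is reindexed by ['I_2] to apply
    this to matrices. *)
Lemma unitary1_adj (w : qubit_op R) : unitary1 w ->
  forall b b', \sum_(c : bool) conjc (w c b) * w c b' = (b == b')%:R.
Proof.
move=> hw b b'; pose f (i : 'I_2) := i == 1.
pose M := \matrix_(i < 2, j < 2) w (f i) (f j).
pose N := \matrix_(i < 2, j < 2) conjc (w (f j) (f i)).
have fI i j : (f i == f j) = (i == j) by case: i j => [[|[]]] // ? [[|[]]].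
have hf (F : bool -> C) : \sum_(c : bool) F c = \sum_i F (f i).
  by rewrite big_bool !big_ord_recl big_ord0 addr0 addrC.
have MN : M *m N = 1%:M.
  apply/matrixP => i j; rewrite !mxE -fI -hw hf.
  by apply: eq_bigr => k _; rewrite !mxE.
have [[i <-] [j <-]] : (exists i, f i = b) /\ (exists i, f i = b').
  by split; [exists (if b then 1 else 0); case: b|exists (if b' then 1 else 0); case: b'].
have /matrixP/(_ i j) := mulmx1C MN; rewrite !mxE fI => <-.
by rewrite hf; apply: eq_bigr => k _; rewrite !mxE.
Qed.

Lemma single_layer_isometry u : (forall i, unitary1 (u i)) ->
  op_mul (op_adj (single_layer u)) (single_layer u) = op_id R (m:=m).
Proof.
move=> hu; rewrite single_layer_adj single_layerM; apply: op_ext => x y.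
rewrite /single_layer /op_id; under eq_bigr do rewrite (unitary1_adj (hu _)).
have [->|/eqP ne] := eqVneq x y; first by rewrite big1 // => i _; rewrite eqxx.
have [i hi] : exists i, x i != y i.
  by apply/forallPn; apply: contra_notN ne => /forallP h; apply/ffunP => i; apply/eqP.
by rewrite (bigD1 i) //= (negPf hi) mul0r.
Qed.

Lemma op_mul1 A : op_mul (op_id R (m:=m)) A = A.
Proof.
apply: op_ext => x y; rewrite /op_mul /op_id (bigD1 x) //= eqxx mul1r big1 ?addr0//.
by move=> i; rewrite eq_sym => /negPf->; rewrite mul0r.
Qed.

Lemma trace_sandwich A rho : op_mul (op_adj A) A = op_id R (m:=m) ->
  op_trace (sandwich A rho) = op_trace rho.
Proof. by move=> hA; rewrite /sandwich op_trace_mulC -op_mulA hA op_trace_mulC op_mul1. Qed.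

(** Off [S] the factors of a conjugated matrix unit are [u_i^* u_i = 1], so the support does not
    grow. *)
Lemma degop_single_conj l u X : (forall i, unitary1 (u i)) -> degop l X ->
  degop l (sandwich (op_adj (single_layer u)) X).
Proof.
move=> hu; apply: (degop_map (F := sandwich (op_adj (single_layer u)))).
  move=> {X} X Y; apply: op_ext => x y; rewrite !sandwich_adjE -big_split /=.
  apply: eq_bigr => z _; rewrite -big_split; apply: eq_bigr => w _ /=.
  by rewrite mulrDr mulrDl.
move=> {X} S X hX hS; rewrite (local_decomp hX).
have -> : sandwich (op_adj (single_layer u)) (fun x y =>
    \sum_(p | supported S p.1 && supported S p.2)
      X p.1 p.2 * single_layer (unit_op R S p.1 p.2) x y) =
  fun x y => \sum_(p | supported S p.1 && supported S p.2)
    X p.1 p.2 * sandwich (op_adj (single_layer u)) (single_layer (unit_op R S p.1 p.2)) x y.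
  apply: op_ext => x y; rewrite sandwich_adjE.
  under [RHS]eq_bigr do rewrite sandwich_adjE mulr_sumr.
  rewrite [RHS]exchange_big /=; apply: eq_bigr => z _.
  under [RHS]eq_bigr do rewrite mulr_sumr.
  rewrite [RHS]exchange_big /=; apply: eq_bigr => w _.
  rewrite mulr_sumr mulr_suml; apply: eq_bigr => p _; ring.
apply: degop_sum => p _; apply: (@degop_local _ _ _ S) => //.
apply: local_scale; rewrite /sandwich op_adjK single_layer_adj !single_layerM.
apply: local_single => i hi b b'; rewrite -(unitary1_adj (hu i)).
apply: eq_bigr => c _; congr (_ * _); rewrite (bigD1 c) //= /unit_op (negPf hi).
by rewrite eqxx mul1r big1 ?addr0// => e; rewrite eq_sym => /negPf->; rewrite mul0r.
Qed.

(** If the strings differ somewhere off [T], both entries vanish; hence off [T] only the pattern of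
    agreements matters. *)
Lemma local_agree T X (x y x' y' : bits m) : local_on T X ->
  (forall i, i \in T -> x i = x' i /\ y i = y' i) ->
  (forall i, i \notin T -> (x i == y i) = (x' i == y' i)) -> X x y = X x' y'.
Proof.
move=> [h1 h2] hS hN.
have [h|] := boolP [forall i, (i \notin T) ==> (x i == y i)].
  have {}h i : i \notin T -> x i == y i by move=> hi; move/forallP/(_ i): h; rewrite hi.
  by apply: h2 => // i hi; split; apply/eqP; [|rewrite -hN//]; apply: h.
case/forallPn => i; rewrite negb_imply => /andP[hi hxy].
have -> : X x y = 0 by apply/eqP; apply: contraNT hxy => /h1 ->.
by apply/esym/eqP; move: hxy; rewrite hN//; apply: contraNT => /h1 ->.
Qed.

Lemma local_subset S T X : S \subset T -> local_on S X -> local_on T X.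
Proof.
move=> sST hX; split=> [x y /(hX.1 x y) h i hi|x y x' y' hS hN].
  by apply: h; apply: contraNN hi; apply: (fintype.subsetP sST).
apply: (local_agree hX) => i hi; first exact/hS/(fintype.subsetP sST).
by have [/hS[-> ->]//|/hN[-> ->]] := boolP (i \in T); rewrite !eqxx.
Qed.

Lemma local_mul T X (f : bits m -> bits m -> C) :
  (forall x y x' y' : bits m, (forall i, i \in T -> x i = x' i /\ y i = y' i) ->
    (forall i, i \notin T -> x i = y i /\ x' i = y' i) -> f x y = f x' y') ->
  local_on T X -> local_on T (fun x y => f x y * X x y).
Proof.
move=> hf [h1 h2]; split=> [x y|x y x' y' hS hN].
  by rewrite mulf_eq0 negb_or => /andP[_ /h1].
by rewrite (h2 x y x' y') // (hf x y x' y').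
Qed.

Definition cz_sign (S : {set 'I_m}) (x : bits m) : R :=
  if [forall i in S, x i] then -1 else 1.

Lemma cz_signK S x : cz_sign S x * cz_sign S x = 1.
Proof. by rewrite /cz_sign; case: ifP => _; rewrite ?mulr1 ?mulrNN ?mulr1. Qed.

Lemma eq_cz_sign S (x y : bits m) : (forall i, i \in S -> x i = y i) ->
  cz_sign S x = cz_sign S y.
Proof.
move=> h; rewrite /cz_sign; congr (if _ then _ else _).
by apply: eq_forallb => i; have [/h->|] := boolP (i \in S).
Qed.

Lemma card_bigcup_le (I J : finType) (P : pred I) (F : I -> {set J}) :
  (#|\bigcup_(i | P i) F i| <= \sum_(i | P i) #|F i|)%N.
Proof.
elim/big_rec2: _ => [|i n A _ h]; first by rewrite cards0.
by rewrite (leq_trans (leq_card_setU _ _).1) // leq_add2l.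
Qed.

Lemma pblock_notin (I : finType) (Q : {set {set I}}) i :
  i \notin finset.cover Q -> finset.pblock Q i = finset.set0.
Proof.
move=> iQ; rewrite /finset.pblock; case: pickP => //= B /andP[BQ iB].
by case/negP: iQ; apply/finset.bigcupP; exists B.
Qed.

(** A light-cone argument: gates missing the support of a local term cancel, their signs squaring to
    1. By disjointness each qubit of the support brings in at most one gate, of size at most [t]. *)
Lemma degop_small_gates l t (Q : {set {set 'I_m}}) X : finset.trivIset Q -> (0 < t)%N ->
  (forall S, S \in Q -> (#|S| <= t)%N) -> degop l X ->
  degop (t * l) (diag_conj (fun x => \prod_(S in Q) cz_sign S x) X).
Proof.
move=> tQ t0 hQ; apply: (degop_map (F := diag_conj _)).
  by move=> {X} X Y; apply: op_ext => x y; rewrite /diag_conj mulrDr mulrDl.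
move=> {X} T X hX hT; pose T' := (\bigcup_(i in T) (i |: finset.pblock Q i))%SET.
have sT : T \subset T'.
  by apply/fintype.subsetP => i hi; apply/finset.bigcupP; exists i; rewrite ?setU11.
have cT : (#|T'| <= t * l)%N.
  apply: leq_trans (card_bigcup_le _ _) _.
  apply: (@leq_trans (\sum_(i in T) t)); last by rewrite sum_nat_const mulnC leq_mul2l hT orbT.
  apply: leq_sum => i _; have [iQ|iQ] := boolP (i \in finset.cover Q).
    rewrite (_ : (_ |: _)%SET = finset.pblock Q i) ?hQ ?finset.pblock_mem//.
    by apply/finset.setUidPr; rewrite finset.sub1set finset.mem_pblock.
  (* A qubit in no gate has empty [pblock] and contributes only itself, which is where [0 < t]
     enters. *)
  by rewrite pblock_notin// finset.setU0 cards1.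
apply: (degop_local _ cT).
(* Diagonal conjugation is entrywise multiplication by a kernel; it remains to see that the kernel
   depends on [T'] only. *)
rewrite (_ : diag_conj _ X = fun x y =>
  (\prod_(S in Q) (cz_sign S x * cz_sign S y))%:C * X x y); last first.
  by apply: op_ext => x y; rewrite big_split /diag_conj rmorphM /=; ring.
apply: local_mul; last exact: local_subset sT hX.
move=> x y x' y' hS hN; congr (_ %:C); apply: eq_bigr => S SQ.
have [/existsP[i /andP[iT iS]]|hTS] := boolP [exists i, (i \in T) && (i \in S)].
  have hST j : j \in S -> j \in T'.
    by move=> jS; apply/finset.bigcupP; exists i; rewrite // inE
      (finset.def_pblock tQ SQ iS) jS orbT.
  by congr (_ * _); apply: eq_cz_sign => j /hST /hS[].
(* By disjointness a gate that misses [T] misses all of [T']; there [x] and [y] agree, so the two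
   signs cancel. *)
have hST j : j \in S -> j \notin T'.
  move=> jS; apply: contra hTS => /finset.bigcupP[i iT]; rewrite inE => /orP[|].
    by rewrite inE => /eqP ji; apply/existsP; exists i; rewrite iT -ji.
  move=> jP; apply/existsP; exists i; rewrite iT -(finset.def_pblock tQ SQ jS).
  rewrite (finset.same_pblock tQ jP) finset.mem_pblock; apply: contraTT jP.
  by move=> /pblock_notin->; rewrite inE.
rewrite (eq_cz_sign (y := y)) ?cz_signK => [|j /hST /hN[]//].
by rewrite (eq_cz_sign (x := x') (y := y')) ?cz_signK// => j /hST /hN[].
Qed.

End Layers.

(** * Degree of diagonal operators and approximation of large CZ gates *)

Section DiagonalDegree.
Local Open Scope complex_scope.
Variables (R : realType) (m : nat).
Local Notation C := (R[i]).
Local Notation op := (op R m).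
Implicit Types (X Y : op) (S T : {set 'I_m}) (f g : bits m -> R).

(** Degree is measured by the effect of left and right multiplication on the locality degree, so
    sums and products of functions obey the usual degree rules directly. *)
Definition diag_degree (r : nat) f := forall l X, degop l X ->
  degop (l + r) (fun x y => (f x)%:C * X x y) /\
  degop (l + r) (fun x y => (f y)%:C * X x y).

Lemma diag_degree_leq r s f : (r <= s)%N -> diag_degree r f -> diag_degree s f.
Proof.
by move=> rs hf l X /hf[h1 h2]; split; [move: h1|move: h2]; apply: degop_leq; rewrite leq_add2l.
Qed.

Lemma diag_degree_cst c : diag_degree 0 (fun=> c).
Proof.
move=> l X hX; rewrite addn0; suff h : degop l (fun x y => c%:C * X x y) by [].
move: X hX; apply: (degop_map (F := fun X x y => c%:C * X x y)).
  by move=> X Y; apply: op_ext => x y; rewrite mulrDr.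
by move=> S X hX; apply: degop_local; apply: local_scale.
Qed.

Lemma diag_degreeM r s f g : diag_degree r f -> diag_degree s g ->
  diag_degree (r + s) (fun x => f x * g x).
Proof.
move=> hf hg l X hX; have [g1 g2] := hg _ _ hX.
have [h1 _] := hf _ _ g1; have [_ h2] := hf _ _ g2.
rewrite [(r + s)%N]addnC addnA; split; [move: h1|move: h2]; congr degop;
  by apply: op_ext => x y; rewrite rmorphM mulrA.
Qed.

Lemma diag_degreeD r f g : diag_degree r f -> diag_degree r g ->
  diag_degree r (fun x => f x + g x).
Proof.
move=> hf hg l X hX; have [f1 f2] := hf _ _ hX; have [g1 g2] := hg _ _ hX.
split; [move: (degop_add f1 g1)|move: (degop_add f2 g2)]; congr degop;
  by apply: op_ext => x y; rewrite rmorphD mulrDl.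
Qed.

Lemma diag_degreeZ r c f : diag_degree r f -> diag_degree r (fun x => c * f x).
Proof. by move=> hf; rewrite -[r]add0n; apply: diag_degreeM => //; apply: diag_degree_cst. Qed.

Lemma diag_degreeB r f g : diag_degree r f -> diag_degree r g ->
  diag_degree r (fun x => f x - g x).
Proof.
move=> hf hg; rewrite (_ : (fun x => _) = fun x => f x + -1 * g x).
  by apply: diag_degreeD => //; apply: diag_degreeZ.
by apply/funext => x; rewrite mulN1r.
Qed.

Lemma diag_degreeX r f k : diag_degree r f -> diag_degree (k * r) (fun x => f x ^+ k).
Proof.
move=> hf; elim: k => [|k IH]; first exact: diag_degree_cst.
rewrite mulSn (_ : (fun x => _) = fun x => f x * f x ^+ k); first exact: diag_degreeM.
by apply/funext => x; rewrite exprS.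
Qed.

Lemma diag_degree_bit i : diag_degree 1 (fun x => (x i)%:R).
Proof.
move=> l; suff h (b : bool) X : degop l X ->
    degop (l + 1) (fun x y => ((if b then x i else y i)%:R : R)%:C * X x y).
  by move=> X hX; split; [apply: (h true)|apply: (h false)].
move: X; apply: (degop_map (F := fun X x y => ((if b then x i else y i)%:R : R)%:C * X x y)).
  by move=> X Y; apply: op_ext => x y; rewrite mulrDr.
move=> S X hX hS; apply: (@degop_local _ _ _ (i |: S)%SET); last first.
  by rewrite cardsU1 addnC leq_add// leq_b1.
apply: (local_mul (f := fun x y => ((if b then x i else y i)%:R : R)%:C)).
  move=> x y x' y' /(_ i) + _; rewrite finset.setU11 => /(_ isT)[-> ->] //.
by apply: local_subset hX; apply: finset.subsetU1.
Qed.

Lemma diag_degree_sum r (I : finType) (P : pred I) (F : I -> bits m -> R) :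
  (forall i, P i -> diag_degree r (F i)) ->
  diag_degree r (fun x => \sum_(i | P i) F i x).
Proof.
move=> h; have -> : (fun x => \sum_(i | P i) F i x) =
    \big[(fun f g x => f x + g x)/(fun=> 0)]_(i | P i) F i.
  by apply/funext => x; rewrite (big_morph (fun f => f x) (id1 := 0)
    (op1 := fun a b => a + b)).
elim/big_rec: _ => [|i f hi hf]; last exact: (diag_degreeD (h i hi) hf).
by apply: (@diag_degree_leq 0) => //; apply: diag_degree_cst.
Qed.

Lemma diag_degree_prod (I : finType) (P : pred I) (r : I -> nat) (F : I -> bits m -> R) :
  (forall i, P i -> diag_degree (r i) (F i)) ->
  diag_degree (\sum_(i | P i) r i) (fun x => \prod_(i | P i) F i x).
Proof.
move=> h; have -> : (fun x => \prod_(i | P i) F i x) =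
    \big[(fun f g x => f x * g x)/(fun=> 1)]_(i | P i) F i.
  by apply/funext => x; rewrite (big_morph (fun f => f x) (id1 := 1)
    (op1 := fun a b => a * b)).
elim/big_rec2: _ => [|i f n hi hf]; first exact: diag_degree_cst.
exact: (diag_degreeM (h i hi) hf).
Qed.

Lemma diag_degree_cheb k f : diag_degree 1 f ->
  diag_degree k (fun x => (cheb (f x) k).1) /\
  diag_degree k.-1 (fun x => (cheb (f x) k).2).
Proof.
move=> hf; have hf2 : diag_degree 2 (fun x => 1 - f x ^+ 2).
  apply: diag_degreeB; last exact: (@diag_degreeX 1 f 2).
  by apply: (@diag_degree_leq 0) => //; apply: diag_degree_cst.
elim: k => [|k [IT IV]] /=; first by split; apply: diag_degree_cst.
split.
  apply: diag_degreeB; first by rewrite -add1n; apply: diag_degreeM.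
  (* The case [k = 0] is separate because [0.-1 = 0]: the product rule would give degree 2 instead
     of 1, but the second component is then 0. *)
  case: k IT IV => [_ _|k IT IV]; last by rewrite -add2n; apply: diag_degreeM.
  rewrite (_ : (fun x => _) = fun=> 0); last by apply/funext => x /=; rewrite mulr0.
  by apply: (@diag_degree_leq 0) => //; apply: diag_degree_cst.
apply: diag_degreeD => //; case: k IT IV => [_ _|k IT IV]; last first.
  by rewrite -add1n; apply: diag_degreeM.
rewrite (_ : (fun x => _) = fun=> 0); last by apply/funext => x /=; rewrite mulr0.
exact: diag_degree_cst.
Qed.

Definition weight S (x : bits m) : nat := (\sum_(i in S) x i)%N.

(** A CZ sign is [1 - 2 AND], and AND is a function of the Hamming weight on [S], to which the
    univariate polynomial is applied. *)
Definition cz_approx (k : {set 'I_m} -> nat) r S (x : bits m) : R :=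
  1 - 2 * and_poly #|S| (k S) r (weight S x)%:R.

Lemma diag_degree_cz_approx k r S : diag_degree (r.*2 * k S) (cz_approx k r S).
Proof.
apply: diag_degreeB; first by apply: (@diag_degree_leq 0) => //; apply: diag_degree_cst.
apply: diag_degreeZ; rewrite /and_poly; apply: diag_degreeX.
set f := fun x : bits m => (weight S x)%:R / (#|S|.-1)%:R : R.
rewrite (_ : (fun x => _) = fun x =>
  (cheb (#|S|%:R / #|S|.-1%:R) (k S)).1^-1 * (cheb (f x) (k S)).1); last first.
  by apply/funext => x; rewrite mulrC.
apply: diag_degreeZ; apply: (diag_degree_cheb _ _).1; rewrite /f.
rewrite (_ : (fun x => _) = fun x : bits m => (#|S|.-1%:R)^-1 * \sum_(i in S) (x i)%:R); last first.
  by apply/funext => x; rewrite mulrC /weight natr_sum.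
by apply/diag_degreeZ/diag_degree_sum => i _; apply: diag_degree_bit.
Qed.

Lemma weight_all S (x : bits m) : [forall i in S, x i] -> weight S x = #|S|.
Proof.
by move=> /forall_inP h; rewrite /weight -sum1_card; apply: eq_bigr => i /h ->.
Qed.

Lemma weight_lt S (x : bits m) : ~~ [forall i in S, x i] -> (weight S x < #|S|)%N.
Proof.
move=> /forall_inPn[i iS hi]; rewrite /weight -sum1_card (bigD1 i) //= (negPf hi).
by rewrite (bigD1 i (P := [in S])) //= add0n add1n ltnS; apply: leq_sum => j _; apply: leq_b1.
Qed.

Lemma cz_sign_norm S x : `|cz_sign R S x| = 1.
Proof. by rewrite /cz_sign; case: ifP; rewrite ?normrN normr1. Qed.

(** The approximation is exact when all bits of [S] are 1 and off by [2 and_poly] otherwise;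
    [and_poly] lying in [[0, 1]] keeps it in [[-1, 1]]. *)
Lemma cz_approxP k r S x : (0 < r)%N -> (1 < #|S|)%N -> (#|S| <= k S ^ 2)%N ->
  `|cz_approx k r S x| <= 1 /\
  `|cz_sign R S x - cz_approx k r S x| <= 2 * 4^-1 ^+ r.
Proof.
move=> r0 S1 hk; rewrite /cz_approx /cz_sign.
have h4 : 4^-1 ^+ r <= 4^-1 :> R.
  by rewrite -[leRHS]expr1 ler_wiXn2l//; lra.
have h0 : 0 <= 4^-1 ^+ r :> R by rewrite exprn_ge0//; lra.
case: ifPn => hS.
  rewrite weight_all // and_poly1 // (_ : 1 - 2 * 1 = -1 :> R); last by ring.
  by rewrite subrr normrN normr1 normr0; split=> //; lra.
have := and_poly_ge0 #|S| (k S) r (weight S x)%:R : 0 <= _ :> R.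
have := @and_poly_le R _ _ r _ S1 hk (weight_lt hS).
set q := and_poly _ _ _ _ => q1 q0.
split; rewrite ler_norml; apply/andP; split; lra.
Qed.

Lemma prod_norm_le1 (I : finType) (P : pred I) (F : I -> R) :
  (forall i, P i -> `|F i| <= 1) -> `|\prod_(i | P i) F i| <= 1.
Proof.
move=> hF; rewrite normr_prod; elim/big_rec: _ => // i x /hF hi hx.
by apply: le_trans (ler_wpM2l (normr_ge0 _) hx) _; rewrite mulr1.
Qed.

(** A hybrid argument: factors are exchanged one at a time and the errors add. The induction also
    carries the bound on the partial product of the [G i], which multiplies the new error. *)
Lemma prod_sub_norm_le (I : finType) (P : pred I) (F G : I -> R) e :
  (forall i, P i -> `|F i| <= 1) -> (forall i, P i -> `|G i| <= 1) ->
  (forall i, P i -> `|F i - G i| <= e) ->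
  `|\prod_(i | P i) F i - \prod_(i | P i) G i| <= \sum_(i | P i) e.
Proof.
move=> hF hG hE.
suff [] : `|\prod_(i | P i) G i| <= 1 /\
  `|\prod_(i | P i) F i - \prod_(i | P i) G i| <= \sum_(i | P i) e by [].
elim/big_rec3: _ => [|i s f g /[dup] hi /hG hGi [hg hs]].
  by rewrite subrr normr0 normr1.
split; first by rewrite normrM mulr_ile1.
rewrite (_ : _ - _ = (F i - G i) * g + F i * (f - g)); last by ring.
apply: le_trans (ler_normD _ _) _; rewrite !normrM lerD//.
  by apply: le_trans (ler_wpM2l (normr_ge0 _) hg) _; rewrite mulr1 hE.
by apply: le_trans (ler_wpM2r (normr_ge0 _) (hF _ hi)) _; rewrite mul1r.
Qed.

End DiagonalDegree.

(** * Input states and Fourier degree *)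

Section Output.
Local Open Scope complex_scope.
Variables (R : realType) (m : nat).

Lemma trace_pairing (rho : op R m) : op_trace rho = pairing (op_id R (m:=m)) rho.
Proof. by rewrite /pairing op_mul1. Qed.

Definition output_projector (o : 'I_m) : op R m :=
  fun z w => ((z == w) && z o)%:R.

Lemma pairing_output (o : 'I_m) (rho : op R m) :
  pairing (output_projector o) rho = \sum_(w : bits m | w o) rho w w.
Proof.
rewrite pairingE [RHS]big_mkcond; apply: eq_bigr => w _.
rewrite (bigD1 w) //= big1 => [|y]; last first.
  by rewrite eq_sym /output_projector => /negPf->; rewrite mul0r.
by rewrite addr0 /output_projector eqxx; case: (w o); rewrite /= ?mul1r ?mul0r.
Qed.

Lemma local_output (o : 'I_m) : local_on [set o]%SET (output_projector o).
Proof.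
rewrite /output_projector; split=> [x y|x y x' y' /(_ o) + hN].
  by case: (eqVneq x y) => [->|_]//; rewrite eqxx.
rewrite finset.set11 => /(_ isT)[ho ho']; rewrite ho; congr ((_ && _)%:R).
apply/eqP/eqP => h; apply/ffunP => i; have [->|ne] := eqVneq i o.
- by rewrite -ho h ho'.
- by have [] := hN i; rewrite ?inE.
- by rewrite ho h -ho'.
- by have [] := hN i; rewrite ?inE.
Qed.

Lemma output_state_bounded (o : 'I_m) : state_bounded (output_projector o) 1.
Proof.
move=> rho hr; rewrite pairing_output mul1r !Re_sum big_mkcond.
have h (x : bits m) : 0 <= complex.Re (rho x x) by exact/Re_ge0/psd_diag_ge0.
rewrite ger0_norm; last by apply: sumr_ge0 => x _; case: ifP.
by apply: ler_sum => x _; case: ifP.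
Qed.

End Output.

Section Input.
Local Open Scope complex_scope.
Variables (R : realType) (n a : nat).
Local Notation C := (R[i]).
Implicit Types (phi : op R a) (X : op R (n + a)) (x : bits n) (y : bits a).

Definition bits_join x y : bits (n + a) :=
  [ffun i => match fintype.split i with inl j => x j | inr k => y k end].

Lemma bits_joinl x y i : bits_join x y (lshift a i) = x i.
Proof. by rewrite ffunE (unsplitK (inl i)). Qed.

Lemma bits_joinr x y i : bits_join x y (rshift n i) = y i.
Proof. by rewrite ffunE (unsplitK (inr i)). Qed.

Lemma sum_input x (F : bits (n + a) -> C) :
  \sum_(w : bits (n + a) | [forall i : 'I_n, w (lshift a i) == x i]) F w = \sum_y F (bits_join x y).
Proof.
rewrite (reindex_onto (bits_join x) (fun w => [ffun j => w (rshift n j)])) /=.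
  apply: eq_bigl => y; apply/andP; split.
    by apply/forallP => i; rewrite bits_joinl.
  by apply/eqP/ffunP => j; rewrite ffunE bits_joinr.
move=> w /forallP h; apply/ffunP => i; rewrite ffunE; case: (split_ordP i) => j ->.
  by rewrite (eqP (h j)).
by rewrite ffunE.
Qed.

(** The input state lives on the strings extending [x], so sums against it collapse to sums over
    ancilla strings. *)
Lemma sum_input2 x phi (G : bits (n + a) -> bits (n + a) -> C) :
  \sum_w \sum_w' G w w' * input_state x phi w w' =
  \sum_y \sum_y' G (bits_join x y) (bits_join x y') * phi y y'.
Proof.
have right_join y : [ffun j => bits_join x y (rshift n j)] = y.
  by apply/ffunP => j; rewrite ffunE bits_joinr.
transitivity (\sum_(w : bits (n + a) | [forall i : 'I_n, w (lshift a i) == x i])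
    \sum_(w' : bits (n + a) | [forall i : 'I_n, w' (lshift a i) == x i])
    G w w' * phi [ffun j => w (rshift n j)] [ffun j => w' (rshift n j)]).
  rewrite [RHS]big_mkcond /=; apply: eq_bigr => w _; rewrite /input_state.
  case: ifPn => hw; last by rewrite big1 // => w' _; rewrite mul0r mulr0.
  rewrite [RHS]big_mkcond /=; apply: eq_bigr => w' _.
  by case: ifPn => hw' /=; rewrite ?mul1r // mul0r mulr0.
rewrite sum_input; apply: eq_bigr => y _; rewrite sum_input.
by apply: eq_bigr => y' _; rewrite !right_join.
Qed.

Lemma psd_input x phi : density phi -> psd (input_state x phi).
Proof.
move=> [h _] v; have := h (fun y => v (bits_join x y)); congr (_ <= _).
under [RHS]eq_bigr do under eq_bigr do rewrite mulrAC.
rewrite (sum_input2 x phi (fun w w' => conjc (v w) * v w')).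
by apply: eq_bigr => y _; apply: eq_bigr => y' _; rewrite mulrAC.
Qed.

Lemma pairing_input X x phi : pairing X (input_state x phi) =
  \sum_y \sum_y' X (bits_join x y') (bits_join x y) * phi y y'.
Proof.
rewrite pairingE exchange_big /=.
exact: (sum_input2 x phi (fun w w' => X w' w)).
Qed.

Lemma trace_input x phi : density phi -> op_trace (input_state x phi) = 1.
Proof.
move=> [_ <-]; rewrite trace_pairing pairing_input; apply: eq_bigr => y _.
rewrite (bigD1 y) //= /op_id eqxx mul1r big1 ?addr0// => y' ne.
rewrite (_ : (_ == _) = false) ?mul0r//; apply: contraNF ne => /eqP h.
by apply/eqP/ffunP => j; rewrite -(bits_joinr x y') h bits_joinr.
Qed.

Lemma pairing_input_local T X phi x x' : local_on T X ->
  (forall i, lshift a i \in T -> x i = x' i) ->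
  pairing X (input_state x phi) = pairing X (input_state x' phi).
Proof.
move=> hX hx; rewrite !pairing_input; apply: eq_bigr => y _.
apply: eq_bigr => y' _; congr (_ * _); apply: (local_agree hX) => i hi.
  case: (split_ordP i) hi => j -> hi; first by rewrite !bits_joinl hx.
  by rewrite !bits_joinr.
by case: (split_ordP i) hi => j -> _; rewrite ?bits_joinl ?bits_joinr ?eqxx.
Qed.

Lemma ReD (z w : C) : complex.Re (z + w) = complex.Re z + complex.Re w.
Proof. by case: z w => [? ?] []. Qed.

Lemma fourierD (f g : bits n -> R) S :
  fourier (fun x => f x + g x) S = fourier f S + fourier g S.
Proof.
by rewrite /fourier -mulrDr -big_split; congr (_ * _); apply: eq_bigr => x _; rewrite mulrDl.
Qed.

Definition flip (i : 'I_n) x : bits n := [ffun j => (j == i) (+) x j].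

Lemma flipK i : involutive (flip i).
Proof. by move=> x; apply/ffunP => j; rewrite !ffunE addKb. Qed.

Lemma chi_flip (S : {set 'I_n}) i x : i \in S -> chi R S (flip i x) = - chi R S x.
Proof.
move=> iS; rewrite /chi (bigD1 i) //= [in RHS](bigD1 i) //= ffunE eqxx /= !exprD.
rewrite (eq_bigr (fun j => x j : nat)) => [|j /andP[_ /negPf hj]]; last by rewrite ffunE hj.
by case: (x i); rewrite /= ?expr0 ?expr1; ring.
Qed.

(** Flipping bit [i] negates the character and fixes [f], so the sum equals its own negative. *)
Lemma fourier_junta (f : bits n -> R) (S : {set 'I_n}) i : i \in S ->
  (forall x, f (flip i x) = f x) -> fourier f S = 0.
Proof.
move=> iS hf; rewrite /fourier; set s := \sum_x _.
suff : s = - s by move=> h; rewrite (_ : s = 0) ?mulr0//; lra.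
rewrite {1}/s (reindex_inj (inv_inj (flipK i))) /= -sumrN.
by apply: eq_bigr => x _; rewrite hf chi_flip // mulrN.
Qed.

(** A term local on [T] yields a function of the inputs in [T] only, and a set of more than [l]
    inputs contains one outside [T]. Sums follow by linearity of the Fourier coefficients. *)
Lemma fdeg_pairing_input l X phi : degop l X ->
  (fdeg (fun x => complex.Re (pairing X (input_state x phi))) <= l)%N.
Proof.
move=> hX; apply/bigmax_leqP => S; apply: contraNT; rewrite -ltnNge => lS.
apply/eqP; elim: hX => {X} [T X hX hT|X Y _ hX _ hY].
  have [i iS iT] : exists2 i, i \in S & lshift a i \notin T.
    apply/exists_inP; apply: contraTT lS => /exists_inPn h; rewrite -leqNgt.
    rewrite -(card_imset _ (@lshift_inj n a)); apply: leq_trans hT.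
    apply/subset_leq_card/fintype.subsetP => _ /imsetP[i iS ->].
    by have := h i iS; rewrite negbK.
  apply: (fourier_junta iS) => x; congr complex.Re; apply: (pairing_input_local _ hX).
  by move=> j jT; rewrite ffunE; case: eqVneq jT iT => // -> ->.
rewrite -[RHS]addr0 -{1}hX -hY -fourierD; congr fourier; apply/funext => x.
rewrite -ReD !pairingE -big_split; congr complex.Re; apply: eq_bigr => w _ /=.
by rewrite -big_split; apply: eq_bigr => w' _; rewrite mulrDl.
Qed.

Lemma fdeg_le_n (f : bits n -> R) : (fdeg f <= n)%N.
Proof. by apply/bigmax_leqP => S _; rewrite -[leqRHS]card_ord max_card. Qed.

Lemma accept_prob_pairing (o : 'I_(n + a)) U phi x : accept_prob o U phi x =
  complex.Re (pairing (output_projector R o) (sandwich U (input_state x phi))).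
Proof. by rewrite pairing_output. Qed.

End Input.

(** * Passing through the circuit *)

Lemma ceil_sqrt_exists s : exists k, (s <= k ^ 2)%N.
Proof. by exists s; rewrite expnS expn1; case: s => // s; rewrite leq_pmulr. Qed.

Definition ceil_sqrt s := ex_minn (ceil_sqrt_exists s).

(** Minimality gives [(k - 1)^2 < s], and [k <= 2 (k - 1)] once [k >= 2]. *)
Lemma ceil_sqrtP s : (s <= ceil_sqrt s ^ 2)%N /\ (ceil_sqrt s ^ 2 <= 4 * s)%N.
Proof.
rewrite /ceil_sqrt; case: ex_minnP => k hk kmin; split=> //.
case: k hk kmin => [|k] hk kmin; first by rewrite exp0n.
have hs : (k ^ 2 < s)%N by rewrite ltnNge; apply/negP => /kmin; rewrite ltnn.
case: k hs {hk kmin} => [|k]; first by case: s => // s _; rewrite exp1n; case: s.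
move=> hs; apply: leq_trans (_ : 4 * k.+1 ^ 2 <= _)%N; last by rewrite leq_mul2l ltnW.
by rewrite -[4%N]/(2 ^ 2)%N -expnMn leq_exp2r // mul2n -addnn addSnnS leq_addl.
Qed.

Section Evolution.
Local Open Scope complex_scope.
Variables (R : realType) (m : nat).
Hypothesis m_gt0 : (0 < m)%N.
Local Notation C := (R[i]).
Local Notation op := (op R m).
Implicit Types (X Y rho : op).

Lemma sum_card_le (P : {set {set 'I_m}}) : finset.trivIset P ->
  (\sum_(S in P) #|S| <= m)%N.
Proof. by rewrite /finset.trivIset => /eqP->; rewrite -[leqRHS]card_ord max_card. Qed.

Lemma diag_conjM (f g : bits m -> R) X :
  diag_conj (fun x => f x * g x) X = diag_conj f (diag_conj g X).
Proof. by apply: op_ext => x y; rewrite /diag_conj !rmorphM /=; ring. Qed.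

Lemma degop_diag_conj l s f X : diag_degree s f -> degop l X ->
  degop (l + s + s) (diag_conj f X).
Proof.
move=> hf hX; have [h _] := hf _ _ hX; have [_] := hf _ _ h.
by congr degop; apply: op_ext => x y; rewrite /diag_conj; ring.
Qed.

(** For a gate of size [s > y^2] and [k^2 <= 4 s] one has [(k y)^2 <= (2 s)^2], so
    [2 r k <= 4 r s / y]; disjointness bounds the sum of the sizes by [m]. *)
Lemma big_gates_degree (y : R) (Q : {set {set 'I_m}}) r : 1 <= y ->
  finset.trivIset Q ->
  (\sum_(S in Q | y ^+ 2 < #|S|%:R) r.*2 * ceil_sqrt #|S|)%:R <= 4 * r%:R * m%:R / y.
Proof.
move=> y1 tQ; have y0 : 0 < y by lra.
rewrite ler_pdivlMr // natr_sum mulr_suml.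
have hm := sum_card_le tQ; rewrite -(ler_nat R) natr_sum in hm.
apply: (@le_trans _ _ (4 * r%:R * \sum_(S in Q) #|S|%:R)); last first.
  by rewrite ler_wpM2l // mulr_ge0.
rewrite mulr_sumr big_mkcondr /=; apply: ler_sum => S _.
case: ifPn => hS; last by rewrite mulr_ge0 // mulr_ge0.
rewrite natrM -mul2n natrM; have [_] := ceil_sqrtP #|S|.
rewrite -(ler_nat R) natrX natrM; set k := (ceil_sqrt _)%:R; set s := #|S|%:R in hS *.
move=> hk; have : k * y <= 2 * s; last first.
  have r0 : 0 <= r%:R :> R by [].
  move=> h; have := ler_wpM2l r0 h; lra.
have k0 : 0 <= k by [].
rewrite -(@ler_pXn2r _ 2) ?nnegrE ?mulr_ge0 // ?(ltW y0)//.
rewrite !exprMn; apply: le_trans (ler_wpM2r (sqr_ge0 y) hk) _.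
have s0 : 0 <= s by [].
have := ler_wpM2l s0 (ltW hS); lra.
Qed.

Lemma layer_approx (y : R) (Q : {set {set 'I_m}}) r l X Xt e :
  1 <= y -> finset.trivIset Q -> (0 < r)%N -> (2 * m <= 2 ^ r)%N ->
  state_bounded X 1 -> 0 <= e -> state_bounded (op_sub X Xt) e -> degop l Xt ->
  exists Xt' l', [/\ degop l' Xt', l'%:R <= y ^+ 2 * l%:R + 8 * r%:R * m%:R / y &
    state_bounded (op_sub (diag_conj (fun x => \prod_(S in Q) cz_sign R S x) X) Xt')
      (e + 5 / m%:R)].
Proof.
move=> y1 tQ r0 hr hX e0 hXt hl; have y0 : 0 < y by lra.
pose big S := y ^+ 2 < (#|S : {set 'I_m}|)%:R.
pose Q1 := [set S in Q | ~~ big S]%SET.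
pose f x := \prod_(S in Q1) cz_sign R S x.
pose s x := \prod_(S in Q | big S) cz_sign R S x.
pose g x := \prod_(S in Q | big S) cz_approx R (fun S => ceil_sqrt #|S|) r S x.
have fsE : (fun x => \prod_(S in Q) cz_sign R S x) = fun x => f x * s x.
  apply/funext => x; rewrite (bigID big) /= mulrC; congr (_ * _).
  by apply: eq_bigl => S; rewrite inE.
have big1 S : big S -> (1 < #|S|)%N.
  by rewrite /big => h; rewrite -(ltr_nat R); apply: le_lt_trans h; apply: exprn_ege1.
have hg S x : S \in Q -> big S ->
    `|cz_approx R (fun S => ceil_sqrt #|S|) r S x| <= 1 /\
    `|cz_sign R S x - cz_approx R (fun S => ceil_sqrt #|S|) r S x| <= 2 * 4^-1 ^+ r.
  by move=> _ /big1 S1; apply: cz_approxP => //; case: (ceil_sqrtP #|S|).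
have f1 x : `|f x| <= 1 by apply: prod_norm_le1 => S _; rewrite cz_sign_norm.
have s1 x : `|s x| <= 1 by apply: prod_norm_le1 => S _; rewrite cz_sign_norm.
have g1 x : `|g x| <= 1 by apply: prod_norm_le1 => S /andP[SQ bS]; have [] := hg S x SQ bS.
have m0 : 0 < m%:R :> R by rewrite ltr0n.
(* There are at most [m] big gates, each with error [2 / 4^r]; as [2^r >= 2 m], the total is at most
   [1 / (2 m)]. *)
have sg x : `|s x - g x| <= m%:R^-1.
  apply: (@le_trans _ _ (\sum_(S in Q | big S) 2 * 4^-1 ^+ r)).
    apply: prod_sub_norm_le => S /andP[SQ bS]; first by rewrite cz_sign_norm.
      by have [] := hg S x SQ bS.
    by have [] := hg S x SQ bS.
  have p0 : 0 <= 4^-1 ^+ r :> R by rewrite exprn_ge0 // invr_ge0.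
  apply: (@le_trans _ _ (\sum_(S in Q) #|S|%:R * (2 * 4^-1 ^+ r))).
    rewrite big_mkcondr /=; apply: ler_sum => S _.
    case: ifPn => bS; last by rewrite mulr_ge0 // mulr_ge0.
    by rewrite ler_peMl ?mulr_ge0 // ler1n ltnW // big1.
  rewrite -mulr_suml -natr_sum.
  apply: (@le_trans _ _ (m%:R * (2 * 4^-1 ^+ r))).
    by rewrite ler_wpM2r ?mulr_ge0 // ler_nat sum_card_le.
  rewrite -[leRHS]mul1r ler_pdivlMr // exprVn.
  have -> : 4 ^+ r = (2 ^ r)%:R ^+ 2 :> R by rewrite natrX -exprM mulnC exprM; congr (_ ^+ _); ring.
  move: hr; rewrite -(ler_nat R) natrM; set z := (2 ^ r)%:R => hz.
  have z0 : 0 < z by lra.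
  rewrite (_ : _ * m%:R = 2 * m%:R ^+ 2 / z ^+ 2); last by ring.
  rewrite ler_pdivrMr ?exprn_gt0// mul1r.
  apply: (@le_trans _ _ ((2 * m%:R) ^+ 2)); first by have := sqr_ge0 (m%:R : R); lra.
  by rewrite ler_pXn2r ?nnegrE //; lra.
pose t := Num.truncn (y ^+ 2).
have ty : t%:R <= y ^+ 2 by rewrite truncn_le exprn_ge0 // ltW.
have t0 : (0 < t)%N by rewrite truncn_gt0 exprn_ege1.
exists (diag_conj (fun x => f x * g x) Xt).
(* The big gates count twice, once for each side of the conjugation; this turns the constant 4 of
   [big_gates_degree] into 8. *)
exists (t * l + \sum_(S in Q | big S) r.*2 * ceil_sqrt #|S|
              + \sum_(S in Q | big S) r.*2 * ceil_sqrt #|S|)%N.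
split.
- rewrite (_ : (fun x => _) = fun x => g x * f x); last by apply/funext => x; rewrite mulrC.
  rewrite diag_conjM; apply: degop_diag_conj.
    by apply: diag_degree_prod => S _; apply: diag_degree_cz_approx.
  apply: degop_small_gates => //.
    by apply: finset.trivIsetS tQ; apply/fintype.subsetP => S; rewrite inE => /andP[].
  move=> S; rewrite inE /big -leNgt => /andP[_ hS].
  by rewrite truncn_ge_nat // exprn_ge0 // ltW.
- rewrite !natrD natrM; have h := big_gates_degree r y1 tQ.
  have : t%:R * l%:R <= y ^+ 2 * l%:R by rewrite ler_wpM2r.
  by move: h; rewrite -/big; lra.
rewrite fsE addrC.
(* The intermediate operator has the approximate gates around the exact [X]: changing the gates
   costs [5 / m], and replacing [X] by [Xt] inside a contraction costs [e]. *)
apply: (@state_bounded_sub_trans _ _ _ (diag_conj (fun x => f x * g x) X)).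
  rewrite -[5 / _]mulr1; apply: state_bounded_diag_perturb => // [|x|x|x].
  - by rewrite invr_gt0.
  - by rewrite normrM mulr_ile1.
  - by rewrite normrM mulr_ile1.
  - by rewrite -mulrBr normrM; apply: le_trans (ler_wpM2r (normr_ge0 _) (f1 x)) _; rewrite mul1r.
rewrite -diag_conj_sub -[e]mulr1 -[X in e * X](expr1n _ 2).
by apply: state_bounded_diag_conj => // x; rewrite normrM mulr_ile1.
Qed.

Lemma op_sub_sandwich A X Y :
  op_sub (sandwich (op_adj A) X) (sandwich (op_adj A) Y) = sandwich (op_adj A) (op_sub X Y).
Proof.
apply: op_ext => x y; rewrite {1}/op_sub !sandwich_adjE -sumrB; apply: eq_bigr => z _.
by rewrite -sumrB; apply: eq_bigr => w _; rewrite /op_sub; ring.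
Qed.

Lemma state_bounded_sandwich A X c : op_mul (op_adj A) A = op_id R (m:=m) ->
  state_bounded X c -> state_bounded (sandwich (op_adj A) X) c.
Proof.
move=> hA hX rho hr; rewrite -pairing_sandwich -(trace_sandwich rho hA).
exact/hX/psd_sandwich.
Qed.

Lemma sandwich_cz_layer P rho : sandwich (cz_layer R P) rho =
  diag_conj (fun x => \prod_(S in P) cz_sign R S x) rho.
Proof.
have czE x y : cz_layer R P x y = (x == y)%:R * (\prod_(S in P) cz_sign R S x)%:C.
  rewrite /cz_layer rmorph_prod; congr (_ * _); apply: eq_bigr => S _.
  by rewrite /cz_sign; case: ifP => _; rewrite ?rmorphN rmorph1.
apply: op_ext => x y; rewrite /sandwich /op_mul /op_adj /diag_conj.
rewrite (bigD1 x) //= [X in _ + X]big1 ?addr0 => [|z]; last first.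
  by rewrite eq_sym => /negPf h; rewrite czE h !mul0r.
rewrite (bigD1 y) //= [X in _ * (_ + X)]big1 ?addr0 => [|z]; last first.
  by rewrite eq_sym => /negPf h; rewrite czE h mul0r conjc0 mulr0.
rewrite !czE !eqxx !mul1r (_ : conjc _ = (\prod_(S in P) cz_sign R S y)%:C) ?mulrA//.
exact: conjc_real.
Qed.

Variables (u : nat -> 'I_m -> qubit_op R) (P : nat -> {set {set 'I_m}}).
Variables (r : nat) (ys : nat -> R).
Hypotheses (r_gt0 : (0 < r)%N) (hr : (2 * m <= 2 ^ r)%N).
Hypotheses (ys_ge1 : forall j, 1 <= ys j) (ys_cube : forall j, ys j = ys j.+1 ^+ 3).

(* [ys j] plays the role of [m^(3^-j)]. *)
Definition degree_bound j : R := (1 + j%:R * (8 * r%:R)) * m%:R / ys j.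

(** The observable is arbitrary and [j] counts the layers already crossed: the induction removes the
    outermost layer, replaces [X] by its pullback through it, and passes from [j] to [j + 1]. *)
Lemma circuit_approx d :
  (forall k i, (k <= d)%N -> unitary1 (u k i)) ->
  (forall k, (1 <= k <= d)%N -> finset.trivIset (P k)) ->
  forall j X Xt e l, state_bounded X 1 -> 0 <= e -> state_bounded (op_sub X Xt) e ->
  degop l Xt -> l%:R <= degree_bound j ->
  exists Y l', [/\ degop l' Y, l'%:R <= degree_bound (j + d) &
    forall rho, psd rho ->
    `|complex.Re (pairing X (sandwich (qac0_circuit u P d) rho)) - complex.Re (pairing Y rho)|
      <= (e + d%:R * (5 / m%:R)) * complex.Re (op_trace rho)].
Proof.
elim: d => [|d IH] hu hP j X Xt e l hX e0 hXt hl hj.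
  exists (sandwich (op_adj (single_layer (u 0%N))) Xt), l.
  have hu0 i : unitary1 (u 0%N i) by exact: hu.
  split; [exact: degop_single_conj|by rewrite addn0|move=> rho hrho].
  rewrite /= pairing_sandwich -pairing_sub op_sub_sandwich mul0r addr0.
  by apply: state_bounded_sandwich => //; apply: single_layer_isometry.
have hud i : unitary1 (u d.+1 i) by exact: hu.
have iso := single_layer_isometry hud.
set L := single_layer (u d.+1) in iso.
have y0 : 0 < ys j.+1 by have := ys_ge1 j.+1; lra.
have [] := @layer_approx (ys j.+1) (P d.+1) r l (sandwich (op_adj L) X)
  (sandwich (op_adj L) Xt) e.
- exact: ys_ge1.
- by apply: hP; rewrite /= leqnn.
- exact: r_gt0.
- exact: hr.
- exact: state_bounded_sandwich.
- exact: e0.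
- by rewrite op_sub_sandwich; apply: state_bounded_sandwich.
- exact: degop_single_conj.
move=> X1 [l1 [hX1 hl1 hb1]].
have m0 : 0 < m%:R :> R by rewrite ltr0n.
have [|||||||Y [l2 [hY hl2 hb2]]] := IH _ _ j.+1
  (diag_conj (fun x => \prod_(S in P d.+1) cz_sign R S x) (sandwich (op_adj L) X)) X1
  (e + 5 / m%:R) l1.
- by move=> k i kd; apply: hu; apply: leqW.
- by move=> k /andP[k1 kd]; apply: hP; rewrite k1 leqW.
- suff : forall D, (forall x, `|D x| <= 1) ->
    state_bounded (diag_conj D (sandwich (op_adj L) X)) 1.
    by apply=> x; apply: prod_norm_le1 => S _; rewrite cz_sign_norm.
  move=> D hD; rewrite -[1]mulr1 -[X in _ * X](expr1n _ 2).
  by apply: state_bounded_diag_conj => //; apply: state_bounded_sandwich.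
- by rewrite addr_ge0 // divr_ge0.
- exact: hb1.
- exact: hX1.
- apply: le_trans hl1 _.
  (* With [z = ys j.+1], the factor [z^2] turns [m / z^3] into [m / z]: the old constant is kept and
     the layer adds [8 r] to it. *)
  move: hj; rewrite /degree_bound ys_cube => hj.
  have := ler_wpM2l (sqr_ge0 (ys j.+1)) hj.
  set z := ys j.+1 in y0 *; rewrite -(@natr1 _ j) => h.
  rewrite (_ : (1 + (j%:R + 1) * (8 * r%:R)) * m%:R / z =
    z ^+ 2 * ((1 + j%:R * (8 * r%:R)) * m%:R / z ^+ 3) + 8 * r%:R * m%:R / z); last first.
    by field; apply: lt0r_neq0.
  by rewrite lerD2r.
exists Y, l2; split=> //; first by rewrite addnS -addSn.
move=> rho hrho; rewrite /= !sandwichM sandwich_cz_layer -/L.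
rewrite pairing_sandwich pairing_diag_conj.
rewrite (_ : e + _ = e + 5 / m%:R + d%:R * (5 / m%:R)); first exact: hb2.
by rewrite -(@natr1 _ d); ring.
Qed.

End Evolution.

(** * Estimates for logarithms and real powers, and the final bound *)

Lemma trunc_log_le_ln (R : realType) m : (0 < m)%N ->
  (trunc_log 2 m)%:R <= 2 * ln (m%:R : R).
Proof.
(* This is [ln (1 + x) <= x] at [x = - 1/2]; it is the source of the factor 2. *)
move=> m0; have h2 : 2^-1 <= ln 2 :> R.
  have h : -1 < - 2^-1 :> R by lra.
  have := le_ln1Dx h; rewrite (_ : 1 - 2^-1 = 2^-1 :> R); last by lra.
  by rewrite lnV ?posrE//; lra.
have := trunc_logP (isT : (1 < 2)%N) m0; rewrite -(ler_nat R) => h.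
have : ln ((2 ^ trunc_log 2 m)%:R : R) <= ln m%:R.
  by rewrite ler_ln ?posrE ?ltr0n ?expn_gt0.
rewrite natrX lnXn// -[ln 2 *+ _]mulr_natl => h'.
have t0 : 0 <= (trunc_log 2 m)%:R :> R by [].
have := ler_wpM2l t0 h2; lra.
Qed.

(** The exponent [3^-d ln m] is at most [d / 3^d <= 1]. For deep circuits this makes [m^(1 - 3^-d)]
    comparable to [m]. *)
Lemma powR_root_le_expR (R : realType) (m d : nat) : (0 < m)%N ->
  ln (m%:R : R) <= d%:R -> m%:R `^ (3 ^- d) <= expR 1 :> R.
Proof.
move=> m0 h; rewrite /powR pnatr_eq0 gtn_eqF // ler_expR.
rewrite mulrC ler_pdivrMr ?exprn_gt0// mul1r; apply: (le_trans h).
by rewrite -natrX ler_nat ltnW// ltn_expl.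
Qed.

Lemma powR_cube (R : realType) (m j : nat) :
  m%:R `^ (3 ^- j) = (m%:R `^ (3 ^- j.+1)) ^+ 3 :> R.
Proof.
rewrite -[RHS]powR_mulrn ?powR_ge0 // -powRrM; congr (_ `^ _).
have h : 3 ^+ j != 0 :> R by rewrite expf_neq0 // pnatr_eq0.
by rewrite exprS; field.
Qed.

Lemma powR_compl (R : realType) (m : nat) (x : R) : (0 < m)%N ->
  m%:R `^ (1 - x) = m%:R / m%:R `^ x.
Proof.
move=> m0; rewrite powRB ?powRr1//.
by rewrite pnatr_eq0 gtn_eqF ?implybT.
Qed.

Theorem theorem4p1 (R : realType) :
  exists (K c : R) (k : nat),
  forall (n a d : nat) (hn : (0 < n)%N) (U : op R (n + a)) (phi : op R a),
    is_QAC0 d U -> density phi ->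
    approx_deg_le (accept_prob (lshift a (Ordinal hn)) U phi)
      (c * d%:R / n%:R)
      (K * ((n + a)%:R `^ (1 - 3%:R ^- d))
         * (1 + ln ((n + a)%:R)) ^+ k).
Proof.
(* In the shallow case [d <= L] and [r <= 2 + 2 L] give [1 + 8 d r <= 17 (1 + L)^2]; [expR 1] serves
   the deep case, and 5 is the error constant of a layer. *)
exists (17 + expR 1), 5, 2 => n a d hn U phi [u [P [hu [hP hU]]]] hphi.
have {hU} -> : U = qac0_circuit u P d by apply: op_ext.
set o := lshift a _; have m0 : (0 < n + a)%N by rewrite addn_gt0 hn.
have n0 : 0 < n%:R :> R by rewrite ltr0n.
have nm : n%:R <= (n + a)%:R :> R by rewrite ler_nat leq_addr.
have m1 : 1 <= (n + a)%:R :> R by rewrite ler1n.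
have hypP k : (1 <= k <= d)%N -> finset.trivIset (P k) by move=> /hP[].
set M := (n + a)%:R in nm m1 *; set L := ln M; set y := M `^ (3 ^- d).
have L0 : 0 <= L by rewrite ln_ge0.
have y0 : 0 < y by rewrite powR_gt0 //; lra.
rewrite [M `^ _]powR_compl // -/M -/y.
(* If [d > L], the acceptance probability is its own approximant, of degree at most
   [n <= M <= expR 1 * M / y]. *)
have [Ld|dL] := ltP L d%:R.
  exists (accept_prob o (qac0_circuit u P d) phi); split.
    by move=> x; rewrite subrr normr0 divr_ge0 // mulr_ge0.
  apply: (@le_trans _ _ M); first by rewrite (le_trans _ nm) // ler_nat fdeg_le_n.
  have ye : y <= expR 1 by apply: powR_root_le_expR => //; apply: ltW.
  have h1 : M <= (17 + expR 1) * (M / y).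
    by rewrite mulrA ler_pdivlMr // mulrC ler_wpM2r //; lra.
  rewrite -[leLHS]mulr1; apply: ler_pM => //.
  by rewrite exprn_ege1 // lerDl.
(* One unit makes the power of 2 exceed [n + a], the other provides the factor 2 in [hr]. *)
pose r := (trunc_log 2 (n + a)).+2.
have hr : (2 * (n + a) <= 2 ^ r)%N by rewrite expnS leq_mul2l /= ltnW // trunc_log_ltn.
(* The start is the output projector itself, with error 0 and degree 1, matching
   [degree_bound 0 = M / M]. *)
have [||||||| Y [l [hY hl hb]]] := @circuit_approx R (n + a) m0 u P r
    (fun j => M `^ (3 ^- j)) (ltn0Sn _) hr _ (powR_cube R (n + a)) d _ hypP 0%N
    (output_projector R o) (output_projector R o) 0 1%N.
- move=> j; apply: (@le_trans _ _ (M `^ 0)); first by rewrite powRr0.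
  by rewrite ler_powR // invr_ge0 exprn_ge0.
- by move=> k i kd; apply: hu.
- exact: output_state_bounded.
- by [].
- by move=> rho _; rewrite pairing_sub subrr normr0 mul0r.
- by apply: (degop_local (local_output R o)); rewrite cards1.
- rewrite /degree_bound mul0r addr0 mul1r expr0 invr1 powRr1// divff //.
  by apply: lt0r_neq0; lra.
exists (fun x => complex.Re (pairing Y (input_state x phi))); split.
  move=> x; rewrite accept_prob_pairing.
  apply: le_trans (hb _ (psd_input x hphi)) _; rewrite trace_input // mulr1 add0r.
  rewrite -/M mulrCA mulrA ler_pdivrMr; last by lra.
  rewrite mulrAC ler_pdivlMr // ler_wpM2l // mulr_ge0 //.
apply: (@le_trans _ _ l%:R); first by rewrite ler_nat fdeg_pairing_input.
apply: (le_trans hl); rewrite add0n /degree_bound -/M -/y -mulrA [leRHS]mulrAC.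
apply: ler_wpM2r; first by rewrite divr_ge0 // ltW.
have hlog := trunc_log_le_ln R m0; rewrite -/M -/L in hlog.
have r2 : r%:R <= 2 + 2 * L by rewrite /r -!natr1; lra.
have d0 : 0 <= d%:R :> R by [].
have e0 := expR_ge0 (1 : R).
have h1 : d%:R * r%:R <= L * (2 + 2 * L) by apply: ler_pM.
have h2 : 0 <= expR 1 * (1 + L) ^+ 2 by rewrite mulr_ge0 // sqr_ge0.
nra.
Qed.
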